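(* We have $$\underline{sa}_4^s(6) = 11.$$ The minimum $\underline{sa}_4^s(6) = 11$ is attained, e.g., when $X$ is the vertex set of a two-fold pyramid over a parallelogram, and also when $X$ is the vertex set of the convex hull of a $4$-simplex and an additional vertex (a point outside the simplex) sufficiently close to the barycentre of one of the facets of the simplex.
   Context: Let $X=\{x_1,\dots,x_n\}\subset\mathbb{R}^d$ be a finite set (with $x_i\neq x_j$ for $i\ne j$) whose affine hull is $\mathbb{R}^d$, and let $P=\operatorname{conv}X$. Two distinct points $x_i,x_j\in X$ are strictly antipodal (in $X$) if there are different parallel supporting hyperplanes $H',H''$ of $P$ with $X\cap H'=\{x_i\}$ and $X\cap H''=\{x_j\}$. $sa(X)$ is the number of (unordered) strictly antipodal pairs of $X$. $X$ is in strictly convex position if $X=\operatorname{vert}P$ (the vertex set of $P$). $\mathcal{C}_d^s(n)$ is the family of all $X\subset\mathbb{R}^d$ with $|X|=n$, $\operatorname{aff}X=\mathbb{R}^d$, $X$ in strictly convex position, and $\underline{sa}_d^s(n):=\min\{sa(X)\mid X\in\mathcal{C}_d^s(n)\}$. A $k$-fold pyramid over a base polytope is a $k$-fold iterated pyramid over that base (at each step one adds an apex outside the affine hull of the previous polytope and takes the convex hull). *)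

(* Defs.v *)
From HB Require Import structures.
From mathcomp Require Import all_boot all_order all_algebra finmap.
From mathcomp Require Import all_classical all_reals all_analysis.

Set Implicit Arguments.
Unset Strict Implicit.
Unset Printing Implicit Defensive.

Import Order.TTheory GRing.Theory Num.Theory.
Import numFieldNormedType.Exports.

Local Open Scope classical_set_scope.
Local Open Scope ring_scope.

Section Hulls.
Context {R : realType} {V : lmodType R}.
Implicit Types A Q P : set V.

Definition conv_hull A : set V := smallest (@convex_set R V) A.

Definition affine_set A : Prop :=
  forall (x y : V) (t : R), A x -> A y -> A (t *: x + (1 - t) *: y).

Definition aff_hull A : set V := smallest affine_set A.

Definition pyramid Q P : Prop :=
  exists2 p : V, ~ aff_hull Q p & P = conv_hull (Q `|` [set p]).

Fixpoint kfold_pyramid (k : nat) Q P : Prop :=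
  if k is k'.+1 then exists2 Q' : set V, kfold_pyramid k' Q Q' & pyramid Q' P
  else P = Q.

Definition affinely_independent (n : nat) (v : 'I_n -> V) : Prop :=
  forall w : 'I_n -> R,
    \sum_i w i = 0 -> \sum_i w i *: v i = 0 -> forall i, w i = 0.

Definition barycentre (n : nat) (v : 'I_n -> V) : V :=
  n%:R^-1 *: \sum_i v i.

End Hulls.

Section Antipodality.
Context {R : realType} {d : nat}.
Local Notation E := 'rV[R]_d.
Implicit Types (a x y : E) (c : R) (H P X : set E).

Definition dotv a x : R := \sum_i a 0 i * x 0 i.

Definition hyperplane a c : set E := [set x | dotv a x = c].

(* The other side of the hyperplane is obtained by replacing (a, c) with
   (- a, - c). *)
Definition supporting_hyperplane P H : Prop :=
  exists a c, [/\ a != 0, H = hyperplane a c,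
    P `<=` [set x | dotv a x <= c] & P `&` H !=set0].

Definition parallel H' H'' : Prop :=
  exists u : E, H'' = [set u + x | x in H'].

Definition strictly_antipodal X x y : Prop :=
  [/\ X x, X y, x <> y &
    exists H' H'' : set E,
      [/\ H' <> H'', parallel H' H'',
          supporting_hyperplane (conv_hull X) H' /\
          supporting_hyperplane (conv_hull X) H'',
          X `&` H' = [set x] & X `&` H'' = [set y]]].

(* An unordered pair is encoded as the set of its two members; the family
   counted here is finite whenever X is. *)
Definition sa X : nat :=
  #|` fset_set [set p : set E |
        exists x y, strictly_antipodal X x y /\ p = [set x; y]]|.

(* Vertices as 0-dimensional faces, a face being the set of points at which
   a valid linear inequality (possibly with a = 0) is tight. *)
Definition vert P : set E :=
  [set x | exists a c,
     P `<=` [set y | dotv a y <= c] /\ P `&` [set y | dotv a y = c] = [set x]].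

(* [X #= `I_n] says that X is finite with exactly n elements. *)
Definition strictly_convex_family (n : nat) : set (set E) :=
  [set X | [/\ (X #= `I_n)%card, aff_hull X = setT & X = vert (conv_hull X)]].

Definition parallelogram P : Prop :=
  exists a u v : E, row_free (col_mx u v) /\
    P = conv_hull [set a; a + u; a + u + v; a + v].

End Antipodality.

(* The least element of a set of natural numbers, or 0 if it is empty. *)
Definition min_nat (A : set nat) : nat :=
  xget 0%N (A `&` [set m | forall k, A k -> (m <= k)%N]).

Definition min_sa (R : realType) (d n : nat) : nat :=
  min_nat [set sa X | X in @strictly_convex_family R d n].

(* Main.v *)
Require Import Defs.
From mathcomp Require Import all_boot all_order all_algebra finmap.
From mathcomp Require Import all_classical all_reals all_analysis.
From mathcomp Require Import ring lra zify.
Import Order.TTheory GRing.Theory Num.Theory.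
Import numFieldNormedType.Exports.
Local Open Scope ring_scope.

Set Implicit Arguments.
Unset Strict Implicit.
Unset Printing Implicit Defensive.

(* Six points spanning R^4 satisfy a unique affine dependency [lam], up to a
   factor, and a real function on them is the restriction of an affine function
   iff it is orthogonal to [lam]. Let S be the sum of the positive coefficients,
   which is also the sum of the absolute values of the negative ones. Strictly
   convex position means that there are at least two coefficients of either
   sign, and then two points fail to be strictly antipodal iff their
   coefficients have opposite signs and |lam_i| + |lam_j| >= S. Two disjoint bad
   pairs exhaust the mass on both sides, leaving at most 2 * 2 bad pairs;
   otherwise the bad pairs have a common point and there are at most 6 - 2 of
   them. So at most 4 of the 15 pairs are bad.
   Both examples consist of a simplex and a point with given barycentric
   coordinates, and have exactly 4 bad pairs. *)

(** * Real vectors of sum zero *)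

Section AffineDependency.
Context {R : realFieldType} {I : finType}.
Implicit Types (i j k : I) (f F lam : I -> R).

Definition pospart (r : R) : R := Num.max r 0.
Definition negpart (r : R) : R := Num.max (- r) 0.

Lemma pospart_ge0 r : 0 <= pospart r. Proof. by rewrite le_max lexx orbT. Qed.
Lemma negpart_ge0 r : 0 <= negpart r. Proof. by rewrite le_max lexx orbT. Qed.

Lemma pospartBnegpart r : pospart r - negpart r = r.
Proof. by rewrite /pospart /negpart !maxEle; case: ifP; case: ifP; lra. Qed.

Lemma negpart_eq0 r : 0 < pospart r -> negpart r = 0.
Proof. by rewrite /pospart /negpart !maxEle; case: ifP; case: ifP; lra. Qed.

Lemma pospartN r : pospart (- r) = negpart r. Proof. by []. Qed.

Lemma pospart_gt0 r : (0 < pospart r) = (0 < r).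
Proof. by rewrite /pospart lt_max ltxx orbF. Qed.

Lemma negpart_gt0 r : (0 < negpart r) = (r < 0).
Proof. by rewrite /negpart lt_max ltxx orbF oppr_gt0. Qed.

(** Evaluates sums of [lam] against functions that are constant on each sign class: positive mass
    times one value minus negative mass times the other. *)
Lemma mul_parts r u v :
  pospart r * u - negpart r * v = r * (if 0 < r then u else v).
Proof.
rewrite /pospart /negpart; case: (ltP 0 r) => r0.
  by rewrite max_r ?oppr_le0 ?ltW// mul0r subr0.
by rewrite max_l ?oppr_ge0// mul0r sub0r mulNr opprK.
Qed.

Definition mass lam : R := \sum_i pospart (lam i).

(* For the affine dependency [lam] of a point family this says that every Radon
   class has at least two elements, i.e. that the family is in strictly convex
   position. *)
Definition spread lam : Prop :=
  forall i, pospart (lam i) < mass lam /\ negpart (lam i) < mass lam.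

(** The pairs are ordered, positive coefficient first: under [spread lam], membership forces
    [lam q.1 > 0] and [lam q.2 < 0], so no unordered pair is represented twice. *)
Definition nonantipodal lam : {set I * I} :=
  [set q | mass lam <= pospart (lam q.1) + negpart (lam q.2)].

Lemma sum_negpart lam : \sum_i lam i = 0 ->
  \sum_i negpart (lam i) = mass lam.
Proof.
move=> lam0; apply/esym/eqP; rewrite -subr_eq0 -sumrB.
by rewrite (eq_bigr lam) ?lam0// => i _; rewrite pospartBnegpart.
Qed.

Lemma massN lam : \sum_i lam i = 0 -> mass (fun i => - lam i) = mass lam.
Proof. by move=> lam0; rewrite -(sum_negpart lam0). Qed.

Lemma bigD2 F i j : i != j ->
  \sum_k F k = F i + F j + \sum_(k | (k != i) && (k != j)) F k.
Proof.
by move=> ij; rewrite (bigD1 i)//= (bigD1 j) 1?eq_sym//= addrA.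
Qed.

Lemma two_sum_le F i j : (forall k, 0 <= F k) -> i != j ->
  F i + F j <= \sum_k F k.
Proof. by move=> F0 ij; rewrite (bigD2 _ ij) lerDl sumr_ge0. Qed.

Lemma spreadP lam i j k l : \sum_m lam m = 0 -> i != j -> k != l ->
  0 < lam i -> 0 < lam j -> lam k < 0 -> lam l < 0 -> spread lam.
Proof.
move=> lam0 ij kl i0 j0 k0 l0.
(* Whatever [m] is, it differs from [a] or from [b], and that other index contributes a positive
   amount to the sum. *)
have lt_sum F a b m : (forall n, 0 <= F n) -> a != b -> 0 < F a -> 0 < F b ->
    F m < \sum_n F n.
  move=> F0 ab Fa Fb; have [->|ma] := eqVneq m a.
    by apply: lt_le_trans (two_sum_le F0 ab); rewrite ltrDl.
  by apply: lt_le_trans (two_sum_le F0 ma); rewrite ltrDl.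
move=> m; split.
  by apply: (lt_sum (fun n => pospart (lam n)) i j) => // [n||];
    rewrite ?pospart_ge0 ?pospart_gt0.
rewrite -(sum_negpart lam0).
by apply: (lt_sum (fun n => negpart (lam n)) k l) => // [n||];
  rewrite ?negpart_ge0 ?negpart_gt0.
Qed.

(** Off [i] the positive mass is S - p and the negative mass is S - n, where S is the mass and p, n
    are the parts of [lam i]. Giving the positive class the value n - S and the rest the value p - S
    makes the two contributions cancel, and [spread] makes both values negative. *)
Lemma spread_separates lam i : \sum_k lam k = 0 -> spread lam ->
  exists f, [/\ \sum_k lam k * f k = 0, f i = 0 &
    forall k, k != i -> f k < 0].
Proof.
move=> lam0 /(_ i)[pS nS].
exists (fun k => if k == i then 0 else
  if 0 < lam k then negpart (lam i) - mass lam
  else pospart (lam i) - mass lam).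
split; last 2 first.
- by rewrite eqxx.
- by move=> k /negPf->; case: ifP; rewrite subr_lt0.
rewrite (bigD1 i)//= eqxx mulr0 add0r.
rewrite (eq_bigr (fun k => pospart (lam k) * (negpart (lam i) - mass lam)
  - negpart (lam k) * (pospart (lam i) - mass lam))); last first.
  by move=> k /negPf->; rewrite mul_parts.
rewrite sumrB -!mulr_suml.
have := sum_negpart lam0; rewrite (bigD1 i)//= => /(canRL (addKr _)) ->.
have : mass lam = \sum_k pospart (lam k) by [].
rewrite [X in _ = X](bigD1 i)//= => /esym/(canRL (addKr _)) ->.
by ring.
Qed.

(** If [i] carried all the positive mass, every other coefficient would be nonpositive, so every
    term [lam k * f k] would be nonnegative. As they sum to zero, all coefficients off [i] vanish,
    and then so does [lam i]. *)
Lemma vertex_lt_mass lam f i : \sum_k lam k = 0 -> (exists k, lam k != 0) ->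
  \sum_k lam k * f k = 0 -> f i = 0 -> (forall k, k != i -> f k < 0) ->
  pospart (lam i) < mass lam.
Proof.
move=> lam0 [l laml] lamf fi fk; rewrite ltNge; apply/negP => leS.
have p0 k : k != i -> pospart (lam k) = 0.
  move=> ki; apply/eqP; rewrite eq_le pospart_ge0 andbT.
  rewrite -(lerD2r (pospart (lam i))) add0r (le_trans _ leS)//.
  exact: (two_sum_le (fun j => pospart_ge0 (lam j)) ki).
have lamE k : k != i -> lam k = - negpart (lam k).
  by move=> ki; rewrite -{1}(pospartBnegpart (lam k)) p0// sub0r.
have z k : k != i -> lam k = 0.
  move=> ki; have : \sum_(k | k != i) lam k * f k = 0.
    by move: lamf; rewrite (bigD1 i)//= fi mulr0 add0r.
  have t0 j : j != i -> 0 <= lam j * f j.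
    move=> ji; rewrite lamE// mulNr -mulrN mulr_ge0 ?negpart_ge0//.
    by rewrite oppr_ge0 ltW// fk.
  move=> /(psumr_eq0P t0)/(_ k ki)/eqP.
  by rewrite mulf_eq0 (lt_eqF (fk _ ki)) orbF => /eqP.
have zi : lam i = 0.
  by move: lam0; rewrite (bigD1 i)//= big1 ?addr0.
by have [li|/z l0] := eqVneq l i; move: laml; rewrite ?li ?zi ?l0 eqxx.
Qed.

(** The quantities [h k] are nonnegative and sum to [mass lam * D], of which [i] and [j] contribute
    at least (p_i + n_j) [D], with p and n the positive and negative parts. If p_i + n_j reached the
    mass, nothing would remain for the other indices, so [lam] would be supported on [i] and [j],
    against [spread]. *)
Lemma separated_lt_mass lam f i j : \sum_k lam k = 0 -> spread lam -> i != j ->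
  \sum_k lam k * f k = 0 ->
  (forall k, k != i -> f k < f i) -> (forall k, k != j -> f j < f k) ->
  pospart (lam i) + negpart (lam j) < mass lam.
Proof.
move=> lam0 sp ij lamf fi fj; rewrite ltNge; apply/negP => leS.
set D := f i - f j.
have D0 : 0 < D by rewrite subr_gt0 fi// eq_sym.
pose h k := pospart (lam k) * (f k - f j) + negpart (lam k) * (f i - f k).
have hE : \sum_k h k = mass lam * D.
  rewrite (eq_bigr (fun k => lam k * f k + negpart (lam k) * f i
    - pospart (lam k) * f j)).
    rewrite sumrB big_split/= lamf -!mulr_suml sum_negpart// -/(mass lam).
    by rewrite /D; ring.
  move=> k _; rewrite /h.
  by rewrite -[in X in X * f k](pospartBnegpart (lam k)); ring.
have h0 k : 0 <= h k.
  have fik : f k <= f i by have [->|/fi/ltW] := eqVneq k i.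
  have fjk : f j <= f k by have [->|/fj/ltW] := eqVneq k j.
  by rewrite addr_ge0// mulr_ge0 ?pospart_ge0 ?negpart_ge0// subr_ge0.
have rest : \sum_(k | (k != i) && (k != j)) h k = 0.
  apply/eqP; rewrite eq_le sumr_ge0// andbT.
  move: hE; rewrite (bigD2 _ ij) {1 2}/h !subrr !mulr0 addr0 add0r -/D => hE.
  rewrite -(lerD2l (pospart (lam i) * D + negpart (lam j) * D)) hE addr0.
  by rewrite -mulrDl ler_pM2r.
have z k : (k != i) && (k != j) -> pospart (lam k) = 0 /\ negpart (lam k) = 0.
  move=> kij; have := psumr_eq0P (fun k _ => h0 k) rest kij.
  case/andP: kij => /fi fki /fj fjk.
  rewrite /h => /eqP; rewrite paddr_eq0 ?mulr_ge0 ?pospart_ge0 ?negpart_ge0//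
    ?subr_ge0 ?ltW//.
  rewrite !mulf_eq0 !subr_eq0 (gt_eqF fki) (gt_eqF fjk) !orbF.
  by case/andP => /eqP ? /eqP.
have Sp : mass lam = pospart (lam i) + pospart (lam j).
  by rewrite /mass (bigD2 _ ij) [X in _ + X]big1 ?addr0// => k /z[].
have Sn : mass lam = negpart (lam i) + negpart (lam j).
  rewrite -(sum_negpart lam0) (bigD2 _ ij) [X in _ + X]big1 ?addr0// => k.
  by case/z.
have [pi ni] := sp i; have [pj nj] := sp j.
have pi0 : 0 < pospart (lam i) by lra.
by have := negpart_eq0 pi0; lra.
Qed.

(** Look for [f] with value 1 at [i], 0 at [j], t on the remaining positive coefficients and 1 - t
    on the others. Orthogonality to [lam] is then one linear equation in t, and the two hypotheses
    say exactly that its solution satisfies 0 < t and t < 1. *)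
Lemma lt_mass_separates lam i j : \sum_k lam k = 0 -> i != j ->
  pospart (lam i) + negpart (lam j) < mass lam ->
  negpart (lam i) + pospart (lam j) < mass lam ->
  exists f, [/\ \sum_k lam k * f k = 0,
    forall k, k != i -> f k < f i & forall k, k != j -> f j < f k].
Proof.
move=> lam0 ij lt1 lt2.
(* [P] and [N] are the positive and negative masses off [i] and [j]; the equation for [t] is
   [lam i + P * t - N * (1 - t) = 0]. *)
pose P := mass lam - pospart (lam i) - pospart (lam j).
pose N := mass lam - negpart (lam i) - negpart (lam j).
have PE : \sum_(k | (k != i) && (k != j)) pospart (lam k) = P.
  by rewrite /P /mass (bigD2 _ ij); ring.
have NE : \sum_(k | (k != i) && (k != j)) negpart (lam k) = N.
  by rewrite /N -(sum_negpart lam0) (bigD2 _ ij); ring.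
have lamiE := pospartBnegpart (lam i).
have PN : 0 < P + N by rewrite /P /N; lra.
pose t := (N - lam i) / (P + N).
have t0 : 0 < t by rewrite divr_gt0// /N; lra.
have t1 : t < 1 by rewrite ltr_pdivrMr// mul1r /N /P; lra.
have ji : j != i by rewrite eq_sym.
exists (fun k => if k == i then 1 else if k == j then 0 else
  if 0 < lam k then t else 1 - t); split.
- rewrite (bigD2 _ ij) eqxx (negPf ji) eqxx mulr0 mulr1 addr0.
  rewrite (eq_bigr (fun k => pospart (lam k) * t
    - negpart (lam k) * (1 - t))); last first.
    by move=> k /andP[/negPf-> /negPf->]; rewrite mul_parts.
  rewrite sumrB -!mulr_suml PE NE.
  rewrite (_ : _ - _ = (P + N) * t - N); last by ring.
  by rewrite /t mulrC divfK ?gt_eqF//; ring.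
- move=> k ki; rewrite eqxx (negPf ki).
  by case: ifP => //; case: ifP; lra.
- move=> k kj; rewrite (negPf ji) eqxx (negPf kj).
  by do 2! case: ifP => //; lra.
Qed.

Lemma card_gt1_of_lt_sum F i : (forall k, 0 <= F k) ->
  (forall k, F k < \sum_l F l) -> (1 < #|[set k | (0 < F k)%R]|)%N.
Proof.
move=> F0 FS.
have pick (P : pred I) : 0 < \sum_(k | P k) F k -> exists2 k, P k & 0 < F k.
  move=> S0; apply: contrapT => nk; move: S0; rewrite big1 ?ltxx// => k Pk.
  apply/eqP; rewrite eq_le F0 andbT leNgt; apply/negP => ?.
  by apply: nk; exists k.
have [a _ a0] : exists2 k, predT k & 0 < F k.
  by apply: pick; exact: le_lt_trans (FS i).
have [b ba b0] : exists2 k, k != a & 0 < F k.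
  by apply: pick; have := FS a; rewrite (bigD1 a)//= ltrDl.
by apply/card_gt1P; exists a, b; rewrite !inE eq_sym.
Qed.

Lemma card_nonantipodal lam : \sum_k lam k = 0 -> spread lam ->
  (#|nonantipodal lam| <= maxn 4 (#|I| - 2))%N.
Proof.
move=> lam0 sp; set B := nonantipodal lam.
pose Ip := [set k | 0 < pospart (lam k)].
pose In := [set k | 0 < negpart (lam k)].
have BP q : q \in B -> q.1 \in Ip /\ q.2 \in In.
  rewrite !inE; have [p1 n1] := sp q.1; have [p2 n2] := sp q.2.
  by move=> ?; split; lra.
have dis : [disjoint Ip & In].
  rewrite -setI_eq0; apply/eqP/setP => k; rewrite !inE; apply/negP.
  by case/andP => /negpart_eq0 ->; rewrite ltxx.
have [->|[[i j] ijB]] := set_0Vmem B; first by rewrite cards0.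
have Ip1 : (1 < #|Ip|)%N.
  by apply: (card_gt1_of_lt_sum i) => k; [exact: pospart_ge0|case: (sp k)].
have In1 : (1 < #|In|)%N.
  apply: (card_gt1_of_lt_sum i) => k; first exact: negpart_ge0.
  by rewrite sum_negpart//; case: (sp k).
have cardI : (#|Ip| + #|In| <= #|I|)%N.
  by move: dis; rewrite -leq_card_setU => /eqP <-; exact: max_card.
(* Two disjoint bad pairs: adding their inequalities gives at least twice the mass, so [a], [c]
   carry all the positive mass and [b], [e] all the negative mass. *)
have [[[a b] [[c e] [abB ceB ac be]]]|noq] := pselect (exists q q',
    [/\ q \in B, q' \in B, q.1 != q'.1 & q.2 != q'.2]).
  rewrite /= in ac be; rewrite leq_max; apply/orP; left.
  suff /subset_leq_card : B \subset finset.setX [set a; c] [set b; e].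
    by rewrite cardsX !cards2 ac be.
  have Sac := two_sum_le (fun k => pospart_ge0 (lam k)) ac.
  have Sbe := two_sum_le (fun k => negpart_ge0 (lam k)) be.
  rewrite -/(mass lam) in Sac; rewrite sum_negpart// in Sbe.
  move: abB ceB; rewrite !inE/= => abB ceB.
  have three F x y z : (forall k, 0 <= F k) -> \sum_k F k <= F x + F y ->
      x != y -> 0 < F z -> z \in [set x; y].
    move=> F0 FS xy; apply: contraTT; rewrite !inE negb_or => zxy.
    move: FS; rewrite (bigD2 _ xy) (bigD1 z)//= -leNgt => FS.
    have : 0 <= \sum_(k | (k != x) && (k != y) && (k != z)) F k.
      by rewrite sumr_ge0.
    lra.
  apply/fintype.subsetP => -[x y] /BP[].
  rewrite finset.in_setX 2!inE/= => q1 q2.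
  apply/andP; split.
    apply: (three (fun k => pospart (lam k))) => // [k|].
      exact: pospart_ge0.
    by rewrite -/(mass lam); lra.
  apply: (three (fun k => negpart (lam k))) => // [k|].
    exact: negpart_ge0.
  by rewrite sum_negpart//; lra.
rewrite leq_max; apply/orP; right.
(* Without disjoint bad pairs, [B] lies in a single row or a single column of [Ip] times [In]. Both
   factors have at least two elements and are disjoint, so each has at most [#|I| - 2]. *)
have agree q q' : q \in B -> q' \in B -> q.1 != q'.1 -> q.2 = q'.2.
  move=> qB q'B q1; apply/eqP/negP => /negP q2.
  by apply: noq; exists q, q'.
have [[q qB qi]|alli] := pselect (exists2 q, q \in B & q.1 != i).
  suff /subset_leq_card : B \subset finset.setX Ip [set j].
    by rewrite cardsX cards1 muln1 => /leq_trans; apply; lia.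
  apply/fintype.subsetP => -[x y] xyB.
  rewrite finset.in_setX (BP _ xyB).1/= inE.
  have qj : q.2 = j by exact: (agree q (i, j)).
  have [xi|xi] := eqVneq x i; last first.
    by have /= -> := agree _ _ xyB ijB xi.
  by have /= -> := agree _ _ xyB qB _; rewrite ?qj//= xi eq_sym.
suff /subset_leq_card : B \subset finset.setX [set i] In.
  by rewrite cardsX cards1 mul1n => /leq_trans; apply; lia.
apply/fintype.subsetP => -[x y] xyB.
rewrite finset.in_setX (BP _ xyB).2 andbT inE.
by apply/negPn/negP => xi; apply: alli; exists (x, y).
Qed.

End AffineDependency.

Local Open Scope classical_set_scope.
Local Open Scope ring_scope.

(** * Convex and affine hulls *)

Section Hulls.
Context {R : realType} {V : lmodType R}.
Implicit Types A B : set V.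

Lemma convex_setP A : @convex_set R V A <->
  forall (x y : V) (t : R), 0 <= t -> t <= 1 -> A x -> A y ->
    A (t *: x + (1 - t) *: y).
Proof.
split=> [cA x y t t0 t1 Ax Ay|cA x y t].
  have := cA x y (Itv01 t0 t1); rewrite !inE; exact.
by rewrite !inE => Ax Ay; apply: cA.
Qed.

Lemma convex_conv_hull A : @convex_set R V (conv_hull A).
Proof.
apply/convex_setP => x y t t0 t1 Ax Ay B [cB AB].
by apply: (convex_setP B).1 => //; [apply: Ax|apply: Ay]; split.
Qed.

Lemma conv_hullU A B : conv_hull (conv_hull A `|` B) = conv_hull (A `|` B).
Proof.
apply/seteqP; split; apply: smallest_sub; try exact: convex_conv_hull.
- rewrite subUset; split; last by apply: sub_smallest; right.
  by apply: sub_smallest2r; [exact: convex_conv_hull|left].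
- apply: sub_smallest => x [Ax|Bx]; [left|by right].
  exact: sub_smallest Ax.
Qed.

Lemma affine_aff_hull A : affine_set (aff_hull A).
Proof.
move=> x y t Ax Ay B [cB AB].
by apply: (cB x y t); [apply: Ax|apply: Ay]; split.
Qed.

Lemma aff_hull_conv_hull A : aff_hull (conv_hull A) = aff_hull A.
Proof.
apply/seteqP; split; apply: smallest_sub; try exact: affine_aff_hull.
- apply: smallest_sub; last exact: sub_gen_smallest.
  apply/convex_setP => x y t _ _; exact: affine_aff_hull.
- apply: sub_smallest; exact: sub_gen_smallest.
Qed.

Lemma affine_set_sum A (I : finType) (v : I -> V) (w : I -> R) :
  affine_set A -> (forall i, A (v i)) -> \sum_i w i = 1 ->
  A (\sum_i w i *: v i).
Proof.
move=> aA Av w1.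
have [i0 _|noI] := pickP (@predT I); last first.
  by move: w1; rewrite big_pred0// => /esym/eqP; rewrite oner_eq0.
(* The translate of [A] by one of its points is a linear subspace. *)
set p := v i0; have Ap : A p by exact: Av.
have AZ u t : A (p + u) -> A (p + t *: u).
  move=> Au; have := aA _ _ t Au Ap; congr A.
  by rewrite scalerDr scalerBl scale1r addrC addrA subrK.
have AD u1 u2 : A (p + u1) -> A (p + u2) -> A (p + (u1 + u2)).
  move=> A1 A2; have := aA _ _ 2^-1 A1 A2.
  have -> : 1 - 2^-1 = 2^-1 :> R by field.
  rewrite -scalerDr addrACA scalerDr -[p + p]mulr2n -[p *+ 2]scaler_nat scalerA.
  rewrite mulVf ?pnatr_eq0// scale1r.
  by move=> /(AZ _ 2); rewrite scalerA mulfV ?scale1r// pnatr_eq0.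
have -> : \sum_i w i *: v i = p + \sum_i w i *: (v i - p).
  under [X in _ = _ + X]eq_bigr do rewrite scalerBr.
  by rewrite sumrB -scaler_suml w1 scale1r addrC subrK.
elim/big_ind: _ => [|u1 u2|i _]; [by rewrite addr0|exact: AD|].
by apply: AZ; rewrite addrC subrK.
Qed.

Lemma convex_set_sum A (I : finType) (v : I -> V) (w : I -> R) :
  @convex_set R V A -> (forall i, A (v i)) -> (forall i, 0 <= w i) ->
  \sum_i w i = 1 -> A (\sum_i w i *: v i).
Proof.
move=> /convex_setP cA Av w0 w1.
(* Induct on partial sums, rescaled by their total weight [t]. If [t] is zero no rescaling is
   possible, but then the nonnegative weights all vanish. *)
suff : forall s : seq I, let t := \sum_(i <- s) w i in 0 <= t /\
    if t == 0 then \sum_(i <- s) w i *: v i = 0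
    else A (t^-1 *: \sum_(i <- s) w i *: v i).
  move=> /(_ (index_enum I)) /=; rewrite w1 oner_eq0 invr1 scale1r.
  by case.
elim=> [|i s /= [t0 IH]]; first by rewrite !big_nil /= eqxx.
rewrite !big_cons; set t := \sum_(_ <- _) _ in t0 IH *.
split; first by rewrite addr_ge0.
case: ifPn => [|t1].
  rewrite paddr_eq0// => /andP[/eqP-> t_eq0].
  by move: IH; rewrite t_eq0 scale0r add0r.
have p : 0 < w i + t by rewrite lt_neqAle eq_sym t1 addr_ge0.
case: ifPn IH => [/eqP t_eq0 ->|tn0 At].
  by move: t1; rewrite t_eq0 !addr0 => wi0; rewrite scalerA mulVf ?scale1r.
have q0 : 0 <= w i / (w i + t) by rewrite divr_ge0// ltW.
have q1 : w i / (w i + t) <= 1 by rewrite ler_pdivrMr// mul1r lerDl.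
have := cA _ _ _ q0 q1 (Av i) At; congr A.
have -> : 1 - w i / (w i + t) = t / (w i + t) by field; exact: lt0r_neq0.
by rewrite scalerA mulrAC mulfV// mul1r scalerDr scalerA mulrC.
Qed.

(** A dependency with nonzero coefficient at [ord0] could be solved for [v ord0], placing it in the
    affine hull of the others. *)
Lemma affinely_independent_recl (n : nat) (v : 'I_n.+1 -> V) :
  affinely_independent (v \o lift ord0) ->
  ~ aff_hull (range (v \o lift ord0)) (v ord0) -> affinely_independent v.
Proof.
move=> iv nv0 w; rewrite !(big_ord_recl n)/= => w1 wv.
have w0 : w ord0 = 0.
  apply: contra_notP nv0 => /eqP w0.
  have wvE : w ord0 *: v ord0 = - \sum_i w (lift ord0 i) *: v (lift ord0 i).
    by apply/eqP; rewrite -addr_eq0 wv.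
  have w1E : w ord0 = - \sum_i w (lift ord0 i).
    by apply/eqP; rewrite -addr_eq0 w1.
  have -> : v ord0 = \sum_i (- w (lift ord0 i) / w ord0) *: v (lift ord0 i).
    apply: (scalerI w0); rewrite scaler_sumr wvE -sumrN; apply: eq_bigr => i _.
    by rewrite scalerA mulrCA mulfV// mulr1 scaleNr.
  apply: affine_set_sum; first exact: affine_aff_hull.
    by move=> i; apply: sub_gen_smallest; exists i.
  by rewrite -mulr_suml sumrN -w1E mulfV.
move: w1 wv; rewrite w0 scale0r !add0r => w1 wv i.
by case: (unliftP ord0 i) => [j ->|->//]; exact: iv w1 wv j.
Qed.

End Hulls.

(** * Affine dependencies *)

(** The columns of [M] lie in the space orthogonal to [v], whose dimension [n - 1] equals the rank
    [m] of [M]; hence they span it. *)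
Lemma affine_dependency_cokernel (F : fieldType) (n m : nat)
    (M : 'M[F]_(n, m)) (v : 'rV_n) (f : 'cV_n) :
  n = m.+1 -> row_full M -> v != 0 -> v *m M = 0 -> v *m f = 0 ->
  exists b : 'cV_m, f = M *m b.
Proof.
move=> nm fullM v0 vM vf.
have rv : \rank v^T = 1%N by rewrite mxrank_tr rank_rV v0.
have MK : (M^T <= kermx v^T)%MS.
  by apply/sub_kermxP; rewrite -trmx_mul vM trmx0.
have /eqmxP KM : (M^T == kermx v^T)%MS.
  rewrite -(mxrank_leqif_eq MK).2 mxrank_ker rv mxrank_tr.
  have -> : (n - 1)%N = m by rewrite nm subn1.
  exact: fullM.
have : (f^T <= M^T)%MS.
  by rewrite KM; apply/sub_kermxP; rewrite -trmx_mul vf trmx0.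
case/submxP => D fD; exists D^T.
by rewrite -[f]trmxK fD trmx_mul trmxK.
Qed.

Section LinearForms.
Context {R : realType} {d : nat}.
Local Notation E := 'rV[R]_d.
Implicit Types (a b y z : E) (c t : R).

Lemma dotvDr a y z : dotv a (y + z) = dotv a y + dotv a z.
Proof. by rewrite -big_split; apply: eq_bigr => i _; rewrite mxE mulrDr. Qed.

Lemma dotvZr a t y : dotv a (t *: y) = t * dotv a y.
Proof. by rewrite mulr_sumr; apply: eq_bigr => i _; rewrite mxE mulrCA. Qed.

Lemma dotvNl a y : dotv (- a) y = - dotv a y.
Proof. by rewrite -sumrN; apply: eq_bigr => i _; rewrite mxE mulNr. Qed.

Lemma dotv0r a : dotv a 0 = 0.
Proof. by rewrite /dotv big1// => i _; rewrite mxE mulr0. Qed.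

Lemma dotv_sumr (I : finType) a (w : I -> R) (y : I -> E) :
  dotv a (\sum_i w i *: y i) = \sum_i w i * dotv a (y i).
Proof.
elim/big_ind2: _ => [|? ? ? ? <- <-|i _]; [exact: dotv0r| |exact: dotvZr].
exact: dotvDr.
Qed.

Lemma dotv_gt0 a : a != 0 -> 0 < dotv a a.
Proof.
case/rV0Pn => i ai; rewrite /dotv (bigD1 i)//= ltr_pwDl//.
  by rewrite -expr2 exprn_even_gt0.
by rewrite sumr_ge0// => j _; rewrite -expr2 sqr_ge0.
Qed.

(** The zero set of an affine function is an affine set, so the function vanishes everywhere;
    evaluate it at 0 and at [a]. *)
Lemma aff_hull_full_eq0 (X : set E) a c : aff_hull X = setT ->
  (forall y, X y -> dotv a y + c = 0) -> a = 0 /\ c = 0.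
Proof.
move=> XT Xac.
have ac y : dotv a y + c = 0.
  suff : aff_hull X `<=` [set y | dotv a y + c = 0].
    by rewrite XT; apply.
  apply: smallest_sub; last exact: Xac.
  move=> u v t /= /(canRL (addrK _)) + /(canRL (addrK _)).
  by rewrite dotvDr !dotvZr => -> ->; ring.
have c0 : c = 0 by have := ac 0; rewrite dotv0r add0r.
split=> //; apply/eqP/negPn/negP => /dotv_gt0.
by have := ac a; rewrite c0 addr0 => ->; rewrite ltxx.
Qed.

End LinearForms.

Section Families.
Context {R : realType} {d : nat} {I : finType}.
Local Notation E := 'rV[R]_d.
Implicit Types (x : I -> E) (lam f : I -> R).

Definition affine_dependency x lam : Prop :=
  [/\ \sum_i lam i = 0, \sum_i lam i *: x i = 0 & exists i, lam i != 0].

(** Each point gets a final coordinate 1: multiplying by a column evaluates an affine function on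
    the family, and the left kernel consists of the affine dependencies. *)
Let homogenized x : 'M[R]_(#|I|, d + 1) :=
  row_mx (\matrix_k x (enum_val k)) (const_mx 1).

Let homogenized_mul x (b : 'cV[R]_(d + 1)) k :
  (homogenized x *m b) k 0 =
  dotv (usubmx b)^T (x (enum_val k)) + dsubmx b 0 0.
Proof.
rewrite -{1}(vsubmxK b) mul_row_col !mxE; congr (_ + _).
  by apply: eq_bigr => l _; rewrite !mxE mulrC.
by rewrite big_ord1 !mxE mul1r.
Qed.

Let homogenized_full x : aff_hull (range x) = setT -> row_full (homogenized x).
Proof.
move=> xT; rewrite /row_full -mxrank_tr -/(row_free _) -kermx_eq0.
apply/rowV0P => v /sub_kermxP vMt.
have vM : homogenized x *m v^T = 0.
  by apply: trmx_inj; rewrite trmx_mul trmxK vMt trmx0.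
have [||a0 c0] := @aff_hull_full_eq0 R d (range x) (usubmx v^T)^T
    (dsubmx v^T 0 0) => //.
  by move=> _ [i _ <-]; rewrite -[i]enum_rankK -homogenized_mul vM mxE.
apply: trmx_inj; rewrite trmx0 -(vsubmxK v^T) -[usubmx _]trmxK a0 trmx0.
by rewrite [dsubmx _]mx11_scalar c0 raddf0 col_mx0.
Qed.

Let mul_homogenized x (v : 'rV[R]_#|I|) : v *m homogenized x =
  row_mx (\sum_i v 0 (enum_rank i) *: x i) (\sum_i v 0 (enum_rank i))%:M.
Proof.
rewrite mul_mx_row; congr row_mx.
  rewrite mulmx_sum_row (reindex _ (onW_bij _ (enum_rank_bij I))).
  by apply: eq_bigr => i _; rewrite rowK enum_rankK.
apply/matrixP => i j; rewrite !ord1 !mxE eqxx mulr1n.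
rewrite (reindex _ (onW_bij _ (enum_rank_bij I))).
by apply: eq_bigr => k _; rewrite mxE mulr1.
Qed.

Lemma affine_dependency_exists x : (d + 1 < #|I|)%N ->
  aff_hull (range x) = setT -> exists lam, affine_dependency x lam.
Proof.
move=> cI /homogenized_full fx.
have : kermx (homogenized x) != 0.
  by rewrite -mxrank_eq0 mxrank_ker (eqP fx) subn_eq0 -ltnNge.
case/rowV0Pn => v /sub_kermxP; rewrite mul_homogenized => /eqP.
rewrite row_mx_eq0 => /andP[/eqP vx /eqP v1] /rV0Pn[k vk].
exists (fun i => v 0 (enum_rank i)); split=> //.
  by have := congr1 (fun A : 'M[R]_1 => A 0 0) v1; rewrite !mxE eqxx mulr1n.
by exists (enum_val k); rewrite enum_valK.
Qed.

Lemma affine_dependency_orthogonal x lam f a c : affine_dependency x lam ->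
  (forall i, f i = dotv a (x i) + c) -> \sum_i lam i * f i = 0.
Proof.
move=> [lam1 lamx _] fE; under eq_bigr do rewrite fE mulrDr.
by rewrite big_split/= -dotv_sumr lamx dotv0r -mulr_suml lam1 mul0r addr0.
Qed.

(** With [d + 2] points the left kernel of [homogenized x] is a line, spanned by [lam], so
    orthogonality to [lam] alone characterises the restrictions of affine functions. *)
Lemma affine_dependency_interpolate x lam f : #|I| = (d + 2)%N ->
  aff_hull (range x) = setT -> affine_dependency x lam ->
  \sum_i lam i * f i = 0 -> exists a c, forall i, f i = dotv a (x i) + c.
Proof.
move=> cI /homogenized_full fx [lam1 lamx [i0 lami0]] lamf.
pose v := \row_k lam (enum_val k) : 'rV_#|I|.
pose g := \col_k f (enum_val k) : 'cV_#|I|.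
have v0 : v != 0.
  by apply/rV0Pn; exists (enum_rank i0); rewrite mxE enum_rankK.
have vx : v *m homogenized x = 0.
  rewrite mul_homogenized; under eq_bigr do rewrite mxE enum_rankK.
  under [X in X%:M]eq_bigr do rewrite mxE enum_rankK.
  by rewrite lam1 lamx raddf0 row_mx0.
have vg : v *m g = 0.
  apply/matrixP => i j; rewrite !ord1 !mxE.
  rewrite (reindex _ (onW_bij _ (enum_rank_bij I))) -[RHS]lamf.
  by apply: eq_bigr => k _; rewrite !mxE enum_rankK.
have [b gb] : exists b : 'cV_(d + 1), g = homogenized x *m b.
  apply: affine_dependency_cokernel v0 vx vg => //.
  by rewrite cI addnS addn1.
exists (usubmx b)^T, (dsubmx b 0 0) => i.
by rewrite -[i]enum_rankK -homogenized_mul -gb mxE !enum_rankK.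
Qed.

End Families.

(** * Vertices and strictly antipodal pairs *)

Section AntipodalPairs.
Context {R : realType} {d : nat} {I : finType}.
Local Notation E := 'rV[R]_d.
Variable x : I -> E.
Implicit Types (a y : E) (c : R) (i j k : I) (lam f : I -> R).

Let hull := conv_hull (range x).

Let hull_point k : hull (x k).
Proof. by apply: sub_gen_smallest; exists k. Qed.

Lemma conv_hull_le a c : (forall k, dotv a (x k) <= c) ->
  hull `<=` [set y | dotv a y <= c].
Proof.
move=> xc; apply: smallest_sub; last by move=> _ [k _ <-]; exact: xc.
apply/convex_setP => y z t t0 t1 /= yc zc; rewrite dotvDr !dotvZr.
have : t * dotv a y <= t * c by rewrite ler_wpM2l.
have : (1 - t) * dotv a z <= (1 - t) * c by rewrite ler_wpM2l// subr_ge0.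
lra.
Qed.

Lemma conv_hull_lt a c : (forall k, dotv a (x k) < c) ->
  hull `<=` [set y | dotv a y < c].
Proof.
move=> xc; apply: smallest_sub; last by move=> _ [k _ <-]; exact: xc.
apply/convex_setP => y z t t0 t1 /= yc zc; rewrite dotvDr !dotvZr.
have [->|tn0] := eqVneq t 0; first by rewrite mul0r add0r subr0 mul1r.
have : t * dotv a y < t * c by rewrite ltr_pM2l// lt_neqAle eq_sym tn0.
have : (1 - t) * dotv a z <= (1 - t) * c.
  by rewrite ler_wpM2l ?subr_ge0// ltW.
lra.
Qed.

(** If no [x k] attained the level [c], the functional would stay strictly below [c] on the whole
    hull. *)
Lemma vert_conv_hull_sub : vert hull `<=` range x.
Proof.
move=> y [a [c [ac hy]]].
have [Py ayc] : (hull `&` [set z | dotv a z = c]) y by rewrite hy.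
have [[k akc]|nk] := pselect (exists k, dotv a (x k) = c).
  by exists k => //; suff : [set y] (x k) by []; rewrite -hy; split.
have /conv_hull_lt/(_ _ Py)/= : forall k, dotv a (x k) < c.
  move=> k; rewrite lt_neqAle; apply/andP; split; last first.
    exact: (ac _ (hull_point k)).
  by apply/eqP => akc; apply: nk; exists k.
by rewrite ayc ltxx.
Qed.

Lemma vert_conv_hull_point a c i : dotv a (x i) = c ->
  (forall k, k != i -> dotv a (x k) < c) -> vert hull (x i).
Proof.
move=> ai ak; exists a, c.
have le k : dotv a (x k) <= c.
  by have [->|/ak/ltW//] := eqVneq k i; rewrite ai.
split; first exact: conv_hull_le.
apply/seteqP; split=> [y [Py yc]|_ ->]; last by split.
(* An open half-space together with a single point of its boundary is still convex. *)
suff /(_ _ Py)[/=|//] : hull `<=` [set z | dotv a z < c \/ z = x i].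
  by rewrite yc ltxx.
apply: smallest_sub => [|_ [k _ <-]]; last first.
  by have [->|/ak] := eqVneq k i; [right|left].
apply/convex_setP => u v t t0 t1 /=.
have [-> _|tn0] := eqVneq t 0; first by rewrite scale0r add0r subr0 scale1r.
have [-> + _|tn1] := eqVneq t 1; first by rewrite subrr scale0r addr0 scale1r.
have tp : 0 < t by rewrite lt_neqAle eq_sym tn0.
have t'p : 0 < 1 - t by rewrite subr_gt0 lt_neqAle tn1.
have lt_comb (r s : R) : r <= c -> s <= c -> r < c \/ s < c ->
    t * r + (1 - t) * s < c.
  by move=> rc sc [|] ?; nra.
have leP z : dotv a z < c \/ z = x i -> dotv a z <= c.
  by case=> [/ltW//|->]; rewrite ai.
move=> uP vP; have [uc vc] := (leP _ uP, leP _ vP).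
case: uP vP => [u1 _|-> [v1|->]].
- by left; rewrite dotvDr !dotvZr; apply: lt_comb => //; left.
- by left; rewrite dotvDr !dotvZr; apply: lt_comb; rewrite ?ai//; right.
- by right; rewrite -scalerDl addrC subrK scale1r.
Qed.

(** One functional replaces two hyperplanes with a priori unrelated normals: [H''] is a translate of
    [H'], so the functional [a] defining [H'] is constant on [H''] too, and it remains to show that
    this level is its minimum. *)
Lemma strictly_antipodalP i j : injective x -> i != j ->
  strictly_antipodal (range x) (x i) (x j) <->
  exists a, (forall k, k != i -> dotv a (x k) < dotv a (x i)) /\
            (forall k, k != j -> dotv a (x j) < dotv a (x k)).
Proof.
move=> xinj ij; split.
  move=> [_ _ _ [H' [H'' [H'H'' [u H''E]]]]].
  move=> [[a [c [a0 H'E Pac _]]] [b [e [b0 H''E' Pbe _]]]] Xi Xj.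
  have ai : dotv a (x i) = c.
    suff : (range x `&` H') (x i) by rewrite H'E => -[].
    by rewrite Xi.
  have ak k : k != i -> dotv a (x k) < c.
    move=> ki; rewrite lt_neqAle (Pac _ (hull_point k)) andbT.
    apply: contraNN ki => /eqP akc; apply/eqP/xinj.
    suff : (range x `&` H') (x k) by rewrite Xi.
    by split; [exists k|rewrite H'E].
  have bj : dotv b (x j) = e.
    suff : (range x `&` H'') (x j) by rewrite H''E' => -[].
    by rewrite Xj.
  have bk k : k != j -> dotv b (x k) < e.
    move=> kj; rewrite lt_neqAle (Pbe _ (hull_point k)) andbT.
    apply: contraNN kj => /eqP bke; apply/eqP/xinj.
    suff : (range x `&` H'') (x k) by rewrite Xj.
    by split; [exists k|rewrite H''E'].
  set c' := c + dotv a u.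
  have Hc' y : H'' y <-> dotv a y = c'.
    rewrite H''E H'E; split=> [[z /= zc <-]|yc'].
      by rewrite dotvDr zc addrC.
    exists (y - u); last by rewrite addrC subrK.
    by rewrite /hyperplane /= -scaleN1r dotvDr dotvZr yc' /c'; ring.
  have aj : dotv a (x j) = c' by apply/Hc'; rewrite H''E'.
  exists a; rewrite ai aj; split=> // k kj; rewrite ltNge; apply/negP => akc'.
  (* Otherwise the segment from [x k] to [x i] meets [H''], where [b] is
     maximal, although [b] is not maximal at its end points. *)
  have c'c : c' < c by rewrite -aj ak// eq_sym.
  have H''k : dotv a (x k) != c'.
    apply/eqP => /Hc'; rewrite H''E' /= => bke.
    by have := bk _ kj; rewrite bke ltxx.
  have akltc' : dotv a (x k) < c' by rewrite lt_neqAle H''k.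
  pose t := (c' - dotv a (x k)) / (c - dotv a (x k)).
  have D0 : 0 < c - dotv a (x k) by rewrite subr_gt0 (lt_trans akltc').
  have t0 : 0 < t by rewrite divr_gt0// subr_gt0.
  have t1 : t < 1 by rewrite ltr_pdivrMr// mul1r ltrD2r.
  have /Hc' : dotv a (t *: x i + (1 - t) *: x k) = c'.
    rewrite dotvDr !dotvZr ai.
    rewrite (_ : _ + _ = t * (c - dotv a (x k)) + dotv a (x k)); last by ring.
    by rewrite divfK ?gt_eqF// subrK.
  rewrite H''E' /hyperplane /= dotvDr !dotvZr.
  have := bk _ kj; have := bk _ ij => bie bke.
  have : t * dotv b (x i) < t * e by rewrite ltr_pM2l.
  have : (1 - t) * dotv b (x k) < (1 - t) * e by rewrite ltr_pM2l// subr_gt0.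
  lra.
move=> [a [ai aj]].
have aij : dotv a (x j) < dotv a (x i) by apply: aj.
have a0 : a != 0.
  apply: contraTneq aij => ->.
  by rewrite /dotv !big1 ?ltxx// => k _; rewrite mxE mul0r.
split; [by exists i|by exists j|by move/xinj/eqP; rewrite (negPf ij)|].
exists (hyperplane a (dotv a (x i))), (hyperplane a (dotv a (x j))); split.
- move=> /seteqP[/(_ (x i) erefl)/= + _] => /= /eqP.
  by rewrite gt_eqF.
(* Translating by [t *: a] carries the level of [x i] to the level of [x j]. *)
- pose t := (dotv a (x j) - dotv a (x i)) / dotv a a.
  have tE : t * dotv a a = dotv a (x j) - dotv a (x i).
    by rewrite divfK// gt_eqF// dotv_gt0.
  exists (t *: a); apply/seteqP; split=> [y yj|_ [y yi <-]]; last first.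
    by rewrite /hyperplane/= dotvDr dotvZr tE yi subrK.
  exists (y - t *: a); last by rewrite addrC subrK.
  rewrite /hyperplane /= -scaleNr dotvDr dotvZr mulNr tE yj; ring.
- split.
    exists a, (dotv a (x i)); split=> //; last first.
      by exists (x i); split; [exact: hull_point|].
    apply: conv_hull_le => k.
    by have [->//|/ai/ltW] := eqVneq k i.
  exists (- a), (- dotv a (x j)); split.
  + by rewrite oppr_eq0.
  + apply/seteqP; split=> y; rewrite /hyperplane /= dotvNl; first by move=> ->.
    exact: oppr_inj.
  + apply: conv_hull_le => k; rewrite dotvNl lerN2.
    by have [->//|/aj/ltW] := eqVneq k j.
  + exists (x j); split; first exact: hull_point.
    by rewrite /hyperplane.
- apply/seteqP; split=> [_ [[k _ <-] ki]|_ ->]; last by split=> //; exists i.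
  have [->//|/ai] := eqVneq k i.
  by rewrite (ki : dotv a (x k) = _) ltxx.
- apply/seteqP; split=> [_ [[k _ <-] kj]|_ ->]; last by split=> //; exists j.
  have [->//|/aj] := eqVneq k j.
  by rewrite (kj : dotv a (x k) = _) ltxx.
Qed.

End AntipodalPairs.

(** * Counting strictly antipodal pairs through the affine dependency *)

Section Counting.
Context {R : realType} {d : nat} {I : finType}.
Variables (x : I -> 'rV[R]_d) (lam : I -> R).
Hypothesis cardI : #|I| = (d + 2)%N.
Hypothesis xT : aff_hull (range x) = setT.
Hypothesis xlam : affine_dependency x lam.

Let lam0 : \sum_i lam i = 0. Proof. by case: xlam. Qed.

Lemma spread_of_vert : injective x ->
  range x = vert (conv_hull (range x)) -> spread lam.
Proof.
move=> xinj xv i.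
have [a [c [hac hi]]] : vert (conv_hull (range x)) (x i).
  by rewrite -xv; exists i.
pose f k := dotv a (x k) - c.
have lamf : \sum_k lam k * f k = 0.
  exact: (affine_dependency_orthogonal xlam (c := - c)).
have hullx k : conv_hull (range x) (x k) by apply: sub_gen_smallest; exists k.
have fi : f i = 0.
  have [_ /= ac] : (conv_hull (range x) `&` [set z | dotv a z = c]) (x i).
    by rewrite hi.
  by rewrite /f ac subrr.
have fk k : k != i -> f k < 0.
  move=> ki; rewrite subr_lt0 lt_neqAle (hac _ (hullx k)) andbT.
  apply: contraNN ki => /eqP akc; apply/eqP/xinj.
  by suff : [set x i] (x k) by []; rewrite -hi.
have [_ _ lamn0] := xlam.
split; first exact: vertex_lt_mass lamf fi fk.
(* The bound on the negative part is the same lemma applied to the dependency [- lam]. *)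
rewrite -pospartN -(massN lam0).
apply: (vertex_lt_mass (f := f)) => //.
- by rewrite sumrN lam0 oppr0.
- by case: lamn0 => k; exists k; rewrite oppr_eq0.
- by under eq_bigr do rewrite mulNr; rewrite sumrN lamf oppr0.
Qed.

Hypothesis sp : spread lam.

Let separate i : exists a c, dotv a (x i) = c /\
  forall k, k != i -> dotv a (x k) < c.
Proof.
have [f [lamf fi fk]] := spread_separates i lam0 sp.
have [a [c fE]] := affine_dependency_interpolate cardI xT xlam lamf.
exists a, (- c); split; first by apply/eqP; rewrite -addr_eq0 -fE fi.
by move=> k /fk; rewrite fE -[_ < - c]subr_lt0 opprK.
Qed.

Lemma spread_injective : injective x.
Proof.
move=> i j xij; have [a [c [<- ak]]] := separate i.
apply/eqP/negPn/negP; rewrite eq_sym => /ak.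
by rewrite xij ltxx.
Qed.

Lemma vert_conv_hull_range : vert (conv_hull (range x)) = range x.
Proof.
apply/seteqP; split; first exact: vert_conv_hull_sub.
move=> _ [i _ <-]; have [a [c [ai ak]]] := separate i.
exact: vert_conv_hull_point ai ak.
Qed.

Lemma strictly_convex_range : strictly_convex_family #|I| (range x).
Proof.
split; [|exact: xT|by rewrite vert_conv_hull_range].
have -> : range x = range (x \o (@enum_val I predT)).
  apply/seteqP; split=> [_ [i _ <-]|_ [k _ <-]]; last by exists (enum_val k).
  by exists (enum_rank i); rewrite //= enum_rankK.
rewrite card_eq_sym; apply: card_eq_trans card_II _.
rewrite card_eq_sym; apply: inj_card_eq => k l _ _ /spread_injective.
exact: enum_val_inj.
Qed.

Lemma strictly_antipodal_range i j : i != j ->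
  strictly_antipodal (range x) (x i) (x j) <->
  (i, j) \notin nonantipodal lam /\ (j, i) \notin nonantipodal lam.
Proof.
move=> ij; rewrite strictly_antipodalP//; last exact: spread_injective.
rewrite !inE /= -!ltNge; split.
  move=> [a [ai aj]].
  have lamf : \sum_k lam k * dotv a (x k) = 0.
    apply: (affine_dependency_orthogonal (c := 0) xlam) => k.
    by rewrite addr0.
  split; first exact: separated_lt_mass lamf ai aj.
  (* Negating the functional exchanges the roles of [i] and [j]. *)
  have := @separated_lt_mass _ _ lam (fun k => - dotv a (x k)) j i lam0 sp.
  rewrite eq_sym; apply=> //.
  - by under eq_bigr do rewrite mulrN; rewrite sumrN lamf oppr0.
  - by move=> k /aj; rewrite ltrN2.
  - by move=> k /ai; rewrite ltrN2.
move=> [lt1]; rewrite addrC => lt2.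
have [f [lamf fi fj]] := lt_mass_separates lam0 ij lt1 lt2.
have [a [c fE]] := affine_dependency_interpolate cardI xT xlam lamf.
exists a; split=> k; [move=> /fi|move=> /fj]; rewrite !fE ltrD2r; exact.
Qed.

(** The signs of [lam] recover the order of a bad pair, so forgetting it is injective on [B]. The
    complement of [Bad] among the two-element index sets is carried injectively by [img] onto the
    strictly antipodal pairs of points. *)
Lemma sa_range : (sa (range x) + #|nonantipodal lam| = 'C(#|I|, 2))%N.
Proof.
set B := nonantipodal lam.
pose pair (q : I * I) : {set I} := [set q.1; q.2]%SET.
pose Bad := [set pair q | q in B]%SET.
pose Pairs := [set A : {set I} | #|A| == 2]%SET.
have BP q : q \in B -> 0 < lam q.1 /\ lam q.2 < 0.
  rewrite !inE -pospart_gt0 -negpart_gt0.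
  by have [? ?] := sp q.1; have [? ?] := sp q.2; split; lra.
have cardBad : #|Bad| = #|B|.
  apply: card_in_imset => -[i j] [k l] /BP/= [i0 j0] /BP/= [k0 l0] /setP eqq.
  have := eqq i; have := eqq j; rewrite !inE !eqxx orbT /=.
  have [jk|_] := eqVneq j k; first by move: j0; rewrite jk ltNge ltW.
  have [il|_] := eqVneq i l; first by move: i0; rewrite il ltNge ltW.
  by rewrite orbF => /esym/eqP -> /esym/eqP ->.
have BadPairs : Bad \subset Pairs.
  apply/fintype.subsetP => _ /imsetP[[i j] /BP/= [i0 j0] ->].
  rewrite inE cards2; suff -> : i != j by [].
  by apply: contraTneq i0 => ->; rewrite -leNgt ltW.
have mem_Bad i j : (pair (i, j) \in Bad) = ((i, j) \in B) || ((j, i) \in B).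
  apply/imsetP/orP => [[[k l] klB /setP eqq]|[ijB|jiB]].
  - have [k0 l0] := BP _ klB.
    have kl : k != l by apply: contraTneq k0 => ->; rewrite -leNgt ltW.
    have := eqq k; have := eqq l; have := eqq i; have := eqq j.
    move: klB kl; rewrite !inE /= !eqxx !orbT /= => klB /negPf kl.
    move=> /esym/orP[]/eqP jE /esym/orP[]/eqP iE; subst i j.
    + by rewrite orbb eq_sym kl.
    + by right.
    + by left.
    + by rewrite orbb kl.
  - by exists (i, j).
  - by exists (j, i) => //; rewrite /pair/= finset.setUC.
pose img (A : {set I}) : set 'rV[R]_d := x @` [set i | i \in A].
have img_inj : injective img.
  move=> A C /seteqP[AC CA]; apply/setP => i; apply/idP/idP => iA.
    have [k kC /spread_injective <-//] : img C (x i) by apply: AC; exists i.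
  have [k kC /spread_injective <-//] : img A (x i) by apply: CA; exists i.
have imgE i j : img (pair (i, j)) = [set x i; x j].
  apply/seteqP; split=> [_ [k + <-]|_ [->|->]]; last 2 first.
  - by exists i; rewrite //= !inE eqxx.
  - by exists j; rewrite //= !inE eqxx orbT.
  by rewrite /= !inE => /orP[]/eqP->; [left|right].
suff -> : sa (range x) = #|Pairs :\: Bad|.
  by rewrite -cardBad -card_draws cardsDS// subnK// subset_leq_card.
rewrite /sa (_ : [set _ | _] =
    [set` [fset p in map img (enum (Pairs :\: Bad))]%fset]); last first.
  apply/seteqP; split=> [p [_ [_ [[[i _ <-] [j _ <-] xij H] ->]]]|p /=].
    have ij : i != j by apply: contra_notN xij => /eqP ->.
    rewrite /= !inE -imgE map_f// mem_enum !inE mem_Bad.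
    rewrite cards2 ij andbT negb_or.
    apply/andP/(strictly_antipodal_range ij).
    by split.
  rewrite !inE => pimg.
  have /mapP[A] : p \in map img (enum (Pairs :\: Bad)) by exact: pimg.
  rewrite mem_enum !inE => /andP[ABad].
  move=> /cards2P[i [j [ij AE]]] ->; move: ABad.
  rewrite AE -[[set i; j]%SET]/(pair (i, j)) mem_Bad negb_or => /andP sa_ij.
  exists (x i), (x j); split; last exact: imgE.
  exact/strictly_antipodal_range.
rewrite set_fsetK card_fseq undup_id ?map_inj_uniq ?enum_uniq// size_map.
by rewrite -cardE.
Qed.

End Counting.

(** * A simplex together with one more point *)

Section Barycentric.
Context {R : realType} {d : nat}.
Local Notation E := 'rV[R]_d.
Implicit Types (v : 'I_(d + 1) -> E) (y : E).

(** The coordinates of [y] are the entries of (y, 1) times the inverse of the homogenized vertex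
    matrix, hence affine functions of [y]. *)
Lemma barycentric_coordinates v : affinely_independent v ->
  exists (a : 'I_(d + 1) -> E) (c : 'I_(d + 1) -> R), forall y,
    \sum_k (dotv (a k) y + c k) = 1 /\
    \sum_k (dotv (a k) y + c k) *: v k = y.
Proof.
move=> iv; pose M := row_mx (\matrix_k v k) (const_mx 1) : 'M[R]_(d + 1).
have mulM (w : 'rV_(d + 1)) :
    w *m M = row_mx (\sum_k w 0 k *: v k) (\sum_k w 0 k)%:M.
  rewrite mul_mx_row; congr row_mx.
    by rewrite mulmx_sum_row; apply: eq_bigr => k _; rewrite rowK.
  apply/matrixP => i j; rewrite !ord1 !mxE eqxx mulr1n.
  by apply: eq_bigr => k _; rewrite mxE mulr1.
have uM : M \in unitmx.
  rewrite -row_free_unit -kermx_eq0; apply/rowV0P => w /sub_kermxP/eqP.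
  rewrite mulM row_mx_eq0 => /andP[/eqP wv /eqP w1].
  apply/rowP => k; rewrite mxE; apply: (iv (fun k => w 0 k)) => //.
  by have := congr1 (fun A : 'M[R]_1 => A 0 0) w1; rewrite !mxE eqxx mulr1n.
exists (fun k => (col k (usubmx (invmx M)))^T), (fun k => dsubmx (invmx M) 0 k).
move=> y; pose w := row_mx y 1 *m invmx M.
have wE k : w 0 k = dotv (col k (usubmx (invmx M)))^T y + dsubmx (invmx M) 0 k.
  rewrite /w -{1}(vsubmxK (invmx M)) mul_row_col mul1mx mxE; congr (_ + _).
  by rewrite mxE; apply: eq_bigr => l _; rewrite [RHS]mulrC !mxE.
have : w *m M = row_mx y 1 by rewrite -mulmxA mulVmx// mulmx1.
rewrite mulM => /eq_row_mx[wv w1]; split; last first.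
  by rewrite -[RHS]wv; apply: eq_bigr => k _; rewrite wE.
have := congr1 (fun A : 'M[R]_1 => A 0 0) w1; rewrite !mxE eqxx !mulr1n => <-.
by apply: eq_bigr => k _; rewrite wE.
Qed.

Lemma aff_hull_affinely_independent v : affinely_independent v ->
  aff_hull (range v) = setT.
Proof.
move=> /barycentric_coordinates[a [c ac]]; apply/seteqP; split=> // y _.
have [w1 <-] := ac y; apply: affine_set_sum w1; first exact: affine_aff_hull.
by move=> i; apply: sub_gen_smallest; exists i.
Qed.

Lemma dotv_continuous (a : E) : continuous (dotv a).
Proof.
move=> y; have nF : Filter (nbhs y) := nbhs_filter y.
rewrite /dotv; apply: cvg_big => [|i _]; first exact: add_continuous.
by apply: cvgMl_tmp; exact: coord_continuous.
Qed.

End Barycentric.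

Lemma sum_option (V : nmodType) (I : finType) (F : option I -> V) :
  \sum_o F o = F None + \sum_i F (Some i).
Proof.
rewrite (bigD1 None)//=; congr (_ + _).
rewrite (reindex_omap Some id)/=; last by case.
by apply: eq_bigl => i; rewrite eqxx.
Qed.

Section SimplexPlusPoint.
Context {R : realType} {d : nat}.
Variables (v : 'I_(d + 1) -> 'rV[R]_d) (w : 'I_(d + 1) -> R).
Hypothesis iv : affinely_independent v.
Hypothesis w1 : \sum_i w i = 1.

Definition simplex_plus : option 'I_(d + 1) -> 'rV[R]_d :=
  oapp v (\sum_i w i *: v i).

(** The index [None] is the additional point, with coefficient -1 because it equals the combination
    of the simplex vertices with weights [w]. *)
Definition simplex_plus_dep : option 'I_(d + 1) -> R := oapp w (- 1).

Lemma simplex_plus_depP : affine_dependency simplex_plus simplex_plus_dep.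
Proof.
split; rewrite ?sum_option /= ?w1 ?addNr// ?scaleN1r ?addNr//.
by exists None; rewrite /= oppr_eq0 oner_eq0.
Qed.

Lemma range_simplex_plus :
  range simplex_plus = range v `|` [set \sum_i w i *: v i].
Proof.
apply/seteqP; split=> [_ [[i|] _ <-]|_ [[i _ <-]|->]].
- by left; exists i.
- by right.
- by exists (Some i).
- by exists None.
Qed.

Lemma aff_hull_simplex_plus : aff_hull (range simplex_plus) = setT.
Proof.
apply/seteqP; split=> // y _; rewrite range_simplex_plus.
suff : aff_hull (range v) y.
  apply: sub_smallest2r; first exact: affine_aff_hull.
  by move=> z; left.
by rewrite aff_hull_affinely_independent.
Qed.

End SimplexPlusPoint.

(** * Six points in four-space *)

Section FourSpace.
Context {R : realType}.
Local Notation E := 'rV[R]_4.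

Lemma sa_ge11 (X : set E) : strictly_convex_family 6 X -> (11 <= sa X)%N.
Proof.
case=> X6 XT Xv.
have [x xinj xX] : exists2 x : 'I_6 -> E, injective x & range x = X.
  have finX : finite_set X by apply/finite_setP; exists 6%N.
  have size6 : size (fset_set X) = 6%N by exact: card_fset_set X6.
  exists (fun i : 'I_6 => nth 0 (fset_set X) i).
    move=> i j /eqP; rewrite nth_uniq ?size6 ?fset_uniq// => /eqP.
    exact: val_inj.
  rewrite -[RHS](fset_setK finX); apply/seteqP; split=> [_ [i _ <-]|y /=].
    by rewrite /= mem_nth// size6.
  move=> yX; have yi : (index y (fset_set X) < 6)%N by rewrite -size6 index_mem.
  by exists (Ordinal yi); rewrite //= nth_index.
rewrite -xX in XT Xv *.
have [|lam xlam] := affine_dependency_exists _ XT; first by rewrite card_ord.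
have [lam0 _ _] := xlam.
have sp := spread_of_vert xlam xinj Xv.
have c6 : #|'I_6| = (4 + 2)%N by rewrite card_ord.
have := sa_range c6 XT xlam sp; have := card_nonantipodal lam0 sp.
(* For six points both bounds in [maxn 4 (6 - 2)] equal 4. *)
rewrite c6 => B4 saE; rewrite -(leq_add2r 4).
have -> : (11 + 4 = 'C(4 + 2, 2))%N by [].
by rewrite -saE leq_add2l.
Qed.

(** The general lower bound already gives at least 11, so exhibiting four bad pairs is enough. *)
Lemma simplex_plus_sa11 (v : 'I_5 -> E) (w : 'I_5 -> R) :
  affinely_independent v -> \sum_i w i = 1 ->
  let lam := @simplex_plus_dep R 4 w in
  spread lam -> (4 <= #|nonantipodal lam|)%N ->
  let X := vert (conv_hull (range v `|` [set \sum_i w i *: v i])) in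
  strictly_convex_family 6 X /\ sa X = 11%N.
Proof.
move=> iv w1 lam sp B4; rewrite -(@range_simplex_plus R 4 v w).
have c6 : #|{: option 'I_(4 + 1)}| = (4 + 2)%N by rewrite card_option card_ord.
have xT := @aff_hull_simplex_plus R 4 v w iv.
have xlam := @simplex_plus_depP R 4 v w w1.
have [lam0 _ _] := xlam.
rewrite /= (vert_conv_hull_range c6 xT xlam sp).
have XF := strictly_convex_range c6 xT xlam sp.
rewrite c6 in XF; split; first exact: XF.
apply/eqP; rewrite eqn_leq sa_ge11// andbT -(leq_add2r 4).
have -> : (11 + 4 = 'C(4 + 2, 2))%N by [].
by rewrite -c6 -(sa_range c6 xT xlam sp) leq_add2l.
Qed.

(** The negative coefficients are -1 at [None] and [w i], so the mass is [1 - w i]. A facet vertex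
    and the new point form a bad pair as soon as the weight of that vertex is at least [- w i],
    which yields four bad pairs. *)
Lemma simplex_beyond_facet (v : 'I_5 -> E) (w : 'I_5 -> R) (i : 'I_5) :
  affinely_independent v -> \sum_k w k = 1 -> w i < 0 ->
  (forall j, - w i <= w (lift i j)) ->
  let X := vert (conv_hull (range v `|` [set \sum_k w k *: v k])) in
  strictly_convex_family 6 X /\ sa X = 11%N.
Proof.
move=> iv w1 wi wj; have wj0 j : 0 < w (lift i j).
  by apply: lt_le_trans (wj j); rewrite oppr_gt0.
have [lam0 _ _] := @simplex_plus_depP R 4 v w w1.
apply: simplex_plus_sa11 => //.
  apply: (@spreadP _ _ _ (Some (lift i 0)) (Some (lift i 1)) None (Some i));
    rewrite //.
  - by rewrite (inj_eq Some_inj) (inj_eq lift_inj).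
  - exact: wj0.
  - exact: wj0.
  - by rewrite /= oppr_lt0 ltr01.
pose pair (j : 'I_4) : option 'I_5 * option 'I_5 := (Some (lift i j), None).
apply: (@leq_trans #|[set pair j | j : 'I_4]%SET|).
  rewrite card_imset ?card_ord// => j k [jk].
  by apply: (@lift_inj _ i); exact: val_inj.
apply/subset_leq_card/fintype.subsetP => _ /imsetP[j _ ->].
rewrite inE /= -(sum_negpart lam0) sum_option /= [X in _ + X](bigD1 i)//= big1.
  rewrite addr0 addrC lerD2r /negpart /pospart le_max ge_max wj.
  by rewrite ltW.
move=> k; case: (unliftP i k) => [l -> _|->]; last by rewrite eqxx.
by apply: negpart_eq0; rewrite pospart_gt0.
Qed.

Lemma min_sa_4_6 : min_sa R 4 6 = 11%N.
Proof.
(* The origin and the unit vectors, with a sixth point beyond the facet opposite the origin: weight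
   -1/3 at the origin and 1/3 elsewhere has sum 1 and meets the condition [- w i <= w (lift i j)]
   with equality. *)
pose v : 'I_5 -> E := fun k => \row_j (k == lift ord0 j)%:R.
pose w : 'I_5 -> R := fun k => if k == ord0 then - 3^-1 else 3^-1.
have iv : affinely_independent v.
  move=> u u1 uv; have uj j : u (lift ord0 j) = 0.
    have := congr1 (fun y : E => y 0 j) uv; rewrite summxE mxE.
    rewrite (bigD1 (lift ord0 j))//= big1 ?addr0 => [|k kj].
      by rewrite !mxE eqxx mulr1.
    by rewrite !mxE (negPf kj) mulr0.
  move=> k; case: (unliftP ord0 k) => [j ->//|->].
  by move: u1; rewrite big_ord_recl big1 ?addr0.
have w1 : \sum_i w i = 1 by rewrite !big_ord_recl big_ord0 /w /=; field.
have [|j|XF saX] := @simplex_beyond_facet v w ord0 iv w1.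
- by rewrite /w eqxx oppr_lt0 invr_gt0.
- by rewrite /w eqxx opprK.
have min11 k : [set sa X | X in @strictly_convex_family R 4 6] k -> (11 <= k)%N.
  by move=> [Y YF <-]; exact: sa_ge11.
(* The value 11 is attained, so the default 0 of [min_nat] does not come into play. *)
apply: xget_unique; first by split; [eexists; [exact: XF|exact: saX]|].
move=> m [Am mmin]; apply/eqP; rewrite eqn_leq min11// andbT.
by apply: mmin; eexists; [exact: XF|exact: saX].
Qed.

End FourSpace.

(** * The two families of examples *)

Section Examples.
Context {R : realType}.
Local Notation E := 'rV[R]_4.

(** Barycentric coordinates are continuous, and at the barycentre of the facet they are 0 at [i] and
    1/4 elsewhere. A tolerance of 1/8 keeps the facet coordinates above [- w i]. *)
Lemma barycentric_near_facet (v : 'I_5 -> E) (i : 'I_5) :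
  affinely_independent v ->
  \forall p \near (barycentre (fun j : 'I_4 => v (lift i j)) : E),
    exists w : 'I_5 -> R, [/\ \sum_k w k = 1, \sum_k w k *: v k = p,
      - 8^-1 < w i & forall j, 8^-1 < w (lift i j)].
Proof.
move=> iv; have [a [c ac]] := @barycentric_coordinates R 4 v iv.
set b := barycentre _; pose W p k := dotv (a k) p + c k.
pose beta k : R := if k == i then 0 else 4^-1.
have betai : beta i = 0 by rewrite /beta eqxx.
have betaj j : beta (lift i j) = 4^-1.
  by rewrite /beta eq_sym (negPf (neq_lift i j)).
(* Affine independence makes barycentric coordinates unique. *)
have Wb k : W b k = beta k.
  apply/eqP; rewrite -subr_eq0; apply/eqP.
  have [W1 Wv] := ac b.
  apply: (iv (fun k => W b k - beta k)).
    rewrite sumrB W1 (bigD1_ord i)//= betai add0r.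
    rewrite (eq_bigr (fun _ => 4^-1)) => [|j _]; last exact: betaj.
    by rewrite sumr_const card_ord -[_ *+ 4]mulr_natl mulfV ?subrr ?pnatr_eq0.
  under eq_bigr do rewrite scalerBl.
  rewrite sumrB Wv (bigD1_ord i)//= betai scale0r add0r.
  under eq_bigr do rewrite betaj.
  by rewrite -scaler_sumr subrr.
have nF := nbhs_filter b.
have : \forall p \near b, forall k, beta k - 8^-1 < W p k.
  apply: (@filter_forall _ _ (fun k p => beta k - 8^-1 < W p k) _ nF) => k.
  have Wc : W p k @[p --> b] --> W b k.
    by apply: cvgD; [exact: dotv_continuous|exact: cvg_cst].
  by apply: (cvgr_gt _ Wc); rewrite Wb gtrDl oppr_lt0 invr_gt0.
apply: filterS => p Wp; exists (W p); have [W1 Wv] := ac p; split=> //.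
  by have := Wp i; rewrite betai sub0r.
by move=> j; apply: le_lt_trans (Wp _); rewrite betaj; lra.
Qed.

Lemma simplex_near_facet (v : 'I_5 -> E) (i : 'I_5) :
  affinely_independent v ->
  \forall p \near (barycentre (fun j : 'I_4 => v (lift i j)) : E),
    ~ conv_hull (range v) p ->
    let X := vert (conv_hull (conv_hull (range v) `|` [set p])) in
    strictly_convex_family 6 X /\ sa X = 11%N.
Proof.
move=> iv; apply: filterS (barycentric_near_facet i iv).
move=> p [w [w1 <- wi wj]] nhull; rewrite conv_hullU.
apply: (simplex_beyond_facet (i := i)) => //; last first.
  by move=> j; rewrite ltW// (lt_trans _ (wj j))// ltrNl.
(* The other coordinates are positive, so [0 <= w i] would put the point inside the simplex. *)
rewrite ltNge; apply: contra_notN nhull => wi0.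
apply: convex_set_sum => //; first exact: convex_conv_hull.
  by move=> k; apply: sub_gen_smallest; exists k.
move=> k; case: (unliftP i k) => [j ->|->//].
by rewrite ltW// (lt_trans _ (wj j))// invr_gt0.
Qed.

(** The two apexes and three vertices of the parallelogram form a simplex, and the fourth vertex is
    a + u + v = -a + (a + u) + (a + v). The bad pairs are the four sides of the parallelogram. *)
Lemma two_fold_pyramid (Q P : set E) : parallelogram Q -> kfold_pyramid 2 Q P ->
  strictly_convex_family 6 (vert P) /\ sa (vert P) = 11%N.
Proof.
move=> [a [u [v [uv ->]]]] [_ [_ -> [p np ->]] [q nq ->]].
rewrite aff_hull_conv_hull in np; rewrite aff_hull_conv_hull in nq.
rewrite conv_hullU.
set Q4 := [set _; _; _; _] in np nq *.
(* The apexes come first, the last one added at the head, so that [affinely_independent_recl]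
   adjoins them one at a time. *)
pose V : 'I_5 -> E := fun k => nth 0 [:: q; p; a; a + u; a + v] k.
pose w : 'I_5 -> R := fun k => nth 0 [:: 0; 0; - 1; 1; 1] k.
have iv3 : affinely_independent ((V \o lift ord0) \o lift ord0).
  move=> t; rewrite !big_ord_recl !big_ord0 /= /V /= !addr0.
  set t0 := t _; set t1 := t _; set t2 := t _ => t_sum.
  have -> : t0 = - (t1 + t2) by apply/eqP; rewrite -addr_eq0 t_sum.
  move=> tV.
  have /eqP : row_mx t1%:M t2%:M *m col_mx u v = 0.
    move: tV; rewrite scaleNr scalerDl !scalerDr (addrACA (t1 *: a)) addKr.
    by rewrite mul_row_col !mul_scalar_mx.
  rewrite mulmx_free_eq0// row_mx_eq0 => /andP[/eqP t1M /eqP t2M].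
  have t10 : t1 = 0.
    by have := congr1 (fun A : 'M[R]_1 => A 0 0) t1M; rewrite !mxE eqxx mulr1n.
  have t20 : t2 = 0.
    by have := congr1 (fun A : 'M[R]_1 => A 0 0) t2M; rewrite !mxE eqxx mulr1n.
  have t00 : t0 = 0 by move: t_sum; rewrite t10 t20 !addr0.
  move=> k; case: (unliftP ord0 k) => [{}k ->|->//].
  case: (unliftP ord0 k) => [{}k ->|->//].
  by case: (unliftP ord0 k) => [[]|->].
have iv4 : affinely_independent (V \o lift ord0).
  apply: affinely_independent_recl => //.
  apply: contra_not np; apply: sub_smallest2r; first exact: affine_aff_hull.
  move=> _ [[[|[|[|//]]] ?] _ <-]; rewrite /V /= /Q4.
  - by do 3 left.
  - by left; left; right.
  - by right.
have Q4sub : Q4 `<=` conv_hull Q4 by exact: sub_gen_smallest.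
have iv : affinely_independent V.
  apply: affinely_independent_recl => //.
  apply: contra_not nq; apply: sub_smallest2r; first exact: affine_aff_hull.
  move=> _ [[[|[|[|[|//]]]] ?] _ <-]; rewrite /V /=; [by right| | |];
    left; apply: Q4sub.
  - by do 3 left.
  - by left; left; right.
  - by right.
have w1 : \sum_k w k = 1.
  by rewrite !big_ord_recl big_ord0 /w /=; ring.
have wV : \sum_k w k *: V k = a + u + v.
  rewrite !big_ord_recl big_ord0 /w /V /= !scale0r !add0r addr0 !scale1r.
  by rewrite scaleN1r addrA addKr addrCA addrA.
rewrite -setUA conv_hullU.
have -> : Q4 `|` ([set p] `|` [set q]) = range V `|` [set \sum_k w k *: V k].
  rewrite wV; apply/seteqP; split=> y.
    case=> [[[[->|->]|->]|->]|[->|->]]; [left|left|right|left|left|left] => //.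
    + by exists 2%:R.
    + by exists 3%:R.
    + by exists 4%:R.
    + by exists 1%:R.
    + by exists 0.
  case=> [[[[|[|[|[|[|//]]]]] ?] _ <-]|->]; rewrite /V /=.
  - by right; right.
  - by right; left.
  - by left; do 3 left.
  - by left; left; left; right.
  - by left; right.
  - by left; left; right.
have [lam0 _ _] := @simplex_plus_depP R 4 V w w1.
pose i2 : 'I_5 := @Ordinal 5 2 isT; pose i3 : 'I_5 := @Ordinal 5 3 isT.
pose i4 : 'I_5 := @Ordinal 5 4 isT.
pose lam := @simplex_plus_dep R 4 w.
have massE : mass lam = 2.
  rewrite /mass sum_option /= !big_ord_recl big_ord0 /w /=.
  rewrite /pospart !maxEle; do ! case: ifP; lra.
apply: simplex_plus_sa11 => //.
  apply: (@spreadP _ _ _ (Some i3) (Some i4) (Some i2) None) => //.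
  - by rewrite /= /w /= oppr_lt0 ltr01.
  - by rewrite /= oppr_lt0 ltr01.
(* Coefficients +1 sit at [a + u] and [a + v], coefficients -1 at [a] and [a + u + v]; each mixed
   pair reaches the mass 2 exactly. *)
apply: (@leq_trans #|finset.setX [set Some i3; Some i4 : option 'I_5]%SET
    [set Some i2; None]%SET|).
  by rewrite cardsX !cards2.
apply/subset_leq_card/fintype.subsetP => -[s t].
rewrite finset.in_setX => /andP[/= sP tP].
rewrite inE massE /=.
have -> : pospart (lam s) = 1.
  by move: sP; rewrite !inE => /orP[]/eqP ->;
    rewrite /lam /= /w /= /pospart max_l.
have -> : negpart (lam t) = 1; last by lra.
by move: tP; rewrite !inE => /orP[]/eqP ->;
  rewrite /lam /= /w /= /negpart opprK max_l.
Qed.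

End Examples.

Theorem theorem2p9 (R : realType) :
  [/\ min_sa R 4 6 = 11%N,
      (forall Q P : set 'rV[R]_4,
         parallelogram Q -> kfold_pyramid 2 Q P ->
         strictly_convex_family 6 (vert P) /\ sa (vert P) = min_sa R 4 6)
    & (forall v : 'I_5 -> 'rV[R]_4, affinely_independent v ->
         forall i : 'I_5,
         \forall p \near (barycentre (fun j : 'I_4 => v (lift i j)) : 'rV[R]_4),
           ~ conv_hull (range v) p ->
           let X := vert (conv_hull (conv_hull (range v) `|` [set p])) in
           strictly_convex_family 6 X /\ sa X = min_sa R 4 6)].
Proof.
rewrite min_sa_4_6; split=> //; first exact: two_fold_pyramid.
by move=> v iv i; exact: simplex_near_facet.
Qed.
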